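(* Let $m,n\in\mathbb{N}$, $T=\{1,\dots,m\}$, $\mathcal{F}(A,b)=\{x\in\mathbb{R}^n\mid Ax\le b\}$ for $(A,b)\in\mathbb{R}^{m\times n}\times\mathbb{R}^m$, and let $(\bar A,\bar b)$ be such that $\mathcal{F}(\bar A,\bar b)$ is nonempty and bounded. Then $$\operatorname{Lipusc}\mathcal{F}(\bar A,\bar b)=\max_{x\in\mathcal{E}(\bar A,\bar b)}\operatorname{clm}\mathcal{F}\big((\bar A,\bar b),x\big).$$
   Context: $\mathcal{E}(\bar A,\bar b):=\operatorname{extr}\big(\mathcal{F}(\bar A,\bar b)\cap\operatorname{span}\{\bar a_t,\ t\in T\}\big)$, where $\bar a_t'$ is the $t$-th row of $\bar A$ and $\operatorname{extr}$ denotes the set of extreme points. $\mathbb{R}^n$ carries an arbitrary norm $\|\cdot\|$ with dual norm $\|u\|_*=\max_{\|x\|\le1}|u'x|$; the parameter space carries the norm $\|(A,b)\|=\max_{t\in T}\max\{\|a_t\|_*,|b_t|\}$. $\operatorname{dist}(x,\Omega)=\inf_{\omega\in\Omega}\|x-\omega\|$ with $\inf\emptyset=+\infty$. $\operatorname{Lipusc}\mathcal{F}(\bar A,\bar b)$ is the infimum of all $\kappa\ge0$ for which there is a neighborhood $V$ of $(\bar A,\bar b)$ with $\operatorname{dist}(x,\mathcal{F}(\bar A,\bar b))\le\kappa\|(A,b)-(\bar A,\bar b)\|$ for all $(A,b)\in V$, $x\in\mathcal{F}(A,b)$. For $\bar x\in\mathcal{F}(\bar A,\bar b)$, $\operatorname{clm}\mathcal{F}((\bar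 A,\bar b),\bar x)$ is the infimum of all $\kappa\ge0$ for which there are neighborhoods $V$ of $(\bar A,\bar b)$ and $U$ of $\bar x$ with $\operatorname{dist}(x,\mathcal{F}(\bar A,\bar b))\le\kappa\|(A,b)-(\bar A,\bar b)\|$ for all $(A,b)\in V$, $x\in\mathcal{F}(A,b)\cap U$. *)

(* Defs.v *)
From HB Require Import structures.
From mathcomp Require Import all_boot all_order all_algebra.
From mathcomp Require Import all_classical reals ereal.
Set Implicit Arguments. Unset Strict Implicit. Unset Printing Implicit Defensive.
Import Order.TTheory GRing.Theory Num.Theory.
Local Open Scope ring_scope.
Local Open Scope classical_set_scope.

Definition is_norm (R : realType) (n : nat) (N : 'cV[R]_n -> R) : Prop :=
  [/\ forall x, 0 <= N x,
      forall x, N x = 0 -> x = 0,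
      forall (c : R) x, N (c *: x) = `|c| * N x
    & forall x y, N (x + y) <= N x + N y].

Definition dual_norm (R : realType) (n : nat) (N : 'cV[R]_n -> R)
  (u : 'cV[R]_n) : R :=
  sup [set `|(u^T *m x) 0 0| | x in [set x | N x <= 1]].

Definition param_norm (R : realType) (m n : nat) (N : 'cV[R]_n -> R)
  (A : 'M[R]_(m, n)) (b : 'cV[R]_m) : R :=
  \big[Num.max/0]_(t < m) Num.max (dual_norm N (row t A)^T) `|b t 0|.

Definition feas (R : realType) (m n : nat) (A : 'M[R]_(m, n)) (b : 'cV[R]_m)
  : set 'cV[R]_n :=
  [set x | forall t : 'I_m, (A *m x) t 0 <= b t 0].

(* dist(x, Omega) = inf_{w in Omega} ||x - w||, inf of empty = +oo *)
Definition dist (R : realType) (n : nat) (N : 'cV[R]_n -> R)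
  (x : 'cV[R]_n) (Om : set 'cV[R]_n) : \bar R :=
  ereal_inf [set (N (x - w))%:E | w in Om].

Definition extr (R : realType) (n : nat) (S : set 'cV[R]_n) : set 'cV[R]_n :=
  [set x | S x /\ forall (y z : 'cV[R]_n) (l : R), S y -> S z -> 0 < l -> l < 1 ->
      x = l *: y + (1 - l) *: z -> y = z].

Definition row_span (R : realType) (m n : nat) (A : 'M[R]_(m, n)) : set 'cV[R]_n :=
  [set x | exists c : 'cV[R]_m, x = A^T *m c].

Definition Eset (R : realType) (m n : nat) (A : 'M[R]_(m, n)) (b : 'cV[R]_m)
  : set 'cV[R]_n :=
  extr (feas A b `&` row_span A).

Definition Lipusc (R : realType) (m n : nat) (N : 'cV[R]_n -> R)
  (Ab : 'M[R]_(m, n)) (bb : 'cV[R]_m) : \bar R :=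
  ereal_inf [set k%:E | k in [set k : R | 0 <= k /\
    exists2 d : R, 0 < d & forall (A : 'M[R]_(m, n)) (b : 'cV[R]_m),
      param_norm N (A - Ab) (b - bb) < d ->
      forall x, feas A b x ->
        (dist N x (feas Ab bb) <= (k * param_norm N (A - Ab) (b - bb))%:E)%E]].

Definition clm (R : realType) (m n : nat) (N : 'cV[R]_n -> R)
  (Ab : 'M[R]_(m, n)) (bb : 'cV[R]_m) (xb : 'cV[R]_n) : \bar R :=
  ereal_inf [set k%:E | k in [set k : R | 0 <= k /\
    exists2 d : R, 0 < d & exists2 e : R, 0 < e &
      forall (A : 'M[R]_(m, n)) (b : 'cV[R]_m),
      param_norm N (A - Ab) (b - bb) < d ->
      forall x, feas A b x -> N (x - xb) < e ->
        (dist N x (feas Ab bb) <= (k * param_norm N (A - Ab) (b - bb))%:E)%E]].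

(* Main.v *)
Require Import Defs.
From HB Require Import structures.
From mathcomp Require Import all_boot all_order all_algebra.
From mathcomp Require Import all_classical reals ereal topology normedtype derive.
From mathcomp Require Import ring lra.
Set Implicit Arguments. Unset Strict Implicit. Unset Printing Implicit Defensive.
Import Order.TTheory GRing.Theory Num.Theory.
Import numFieldNormedType.Exports.
Local Open Scope ring_scope.
Local Open Scope classical_set_scope.

(** A perturbation of size [P] admits a feasible point [x] as soon as every
    residual of [x] is at most [P (1 + N x)]; conversely (Hahn-Banach) residuals
    bounded by [d (1 + N x)] are absorbed by the perturbation
    [(A - d 1 u^T, b + d 1)] where [u] norms [x].

    Let [x] be arbitrary, [p] a nearest point of [F], and climb inside the minimal
    face of [p] to an extreme point [v] with [N p <= N v]; this is possible because
    the norm is convex.  Constraints active at [p] are active at [v], so [p] is still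
    nearest in the cone generated by [F] at [v].  Hence contracting [x] towards [v],
    [y = v + s (x - v)], gives [dist y F >= s N (x - p)] while the residuals of [y]
    are at most [s] times those of [x].  Calmness at [v] applied to [y], with
    [s -> 0], yields [N (x - p) (1 + N v) <= k rho], [rho] bounding the residuals of
    [x].  If [x] is feasible for a perturbation of size [P], then
    [rho <= P (1 + N x) <= P (1 + N v + N (x - p))], so [N (x - p)] is at most
    [k P / (1 - k P)], which is the required bound up to any factor above 1.  There
    are finitely many extreme points, since they are determined by their active
    constraints. *)

(** * Norms on column vectors *)

Lemma rV_coord_le (R : realType) (n : nat) (v : 'rV[R]_n) i : `|v 0 i| <= `|v|.
Proof.
rewrite [leRHS]/Num.norm /= mx_normrE.
by apply/bigmax_geP; right; exists (0, i).
Qed.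

Lemma lipschitz_rV_continuous (R : realType) (n : nat) (f : 'rV[R]_n -> R) (C : R) :
  0 <= C -> (forall v w, `|f v - f w| <= C * `|v - w|) -> continuous f.
Proof.
move=> C0 f_lip v; have fv : Filter (nbhs v) by exact: nbhs_filter.
apply/cvgrPdist_lt => e e0; apply: (proj2 (@nbhs_ballP R _ v _)).
have C1 : 0 < C + 1 by rewrite ltr_wpDl.
exists (e / (C + 1)) => /=; first by rewrite divr_gt0.
move=> w; rewrite -ball_normE /ball_ /= ltr_pdivlMr// => vw.
rewrite (le_lt_trans (f_lip _ _))// (le_lt_trans _ vw)// mulrC.
by rewrite ler_wpM2l// lerDl.
Qed.

Section Norm.
Variables (R : realType) (n : nat) (N : 'cV[R]_n -> R).
Hypothesis hN : is_norm N.
Implicit Types x y u : 'cV[R]_n.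

Lemma vnorm_ge0 x : 0 <= N x. Proof. by case: hN. Qed.

Lemma vnormZ c x : N (c *: x) = `|c| * N x. Proof. by case: hN. Qed.

Lemma vnormZ_gt0 c x : 0 < c -> c * N x = N (c *: x).
Proof. by move=> c0; rewrite vnormZ gtr0_norm. Qed.

Lemma vnormD x y : N (x + y) <= N x + N y. Proof. by case: hN. Qed.

Lemma vnorm0 : N 0 = 0.
Proof. by rewrite -(scale0r (0 : 'cV_n)) vnormZ normr0 mul0r. Qed.

Lemma vnormN x : N (- x) = N x.
Proof. by rewrite -scaleN1r vnormZ normrN1 mul1r. Qed.

Lemma vnormB_ge x y : N x - N y <= N (x - y).
Proof. by rewrite lerBlDr -{1}(subrK y x) vnormD. Qed.

Lemma vnorm_gt0 x : x != 0 -> 0 < N x.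
Proof.
by case: hN => _ N_eq0 _ _ x0; rewrite lt0r vnorm_ge0 andbT;
  apply: contra x0 => /eqP /N_eq0 ->.
Qed.

Lemma vnorm_sum (I : finType) (F : I -> 'cV[R]_n) :
  N (\sum_i F i) <= \sum_i N (F i).
Proof.
elim/big_ind2: _ => //; first by rewrite vnorm0.
by move=> a b c d ab cd; rewrite (le_trans (vnormD _ _)) ?lerD.
Qed.

Lemma cV_sum_delta x : x = \sum_i x i 0 *: delta_mx i 0.
Proof.
by rewrite {1}[x]matrix_sum_delta; apply: eq_bigr => i _; rewrite big_ord1.
Qed.

Lemma vnorm_le_mx_norm :
  exists2 C, 0 <= C & forall v : 'rV[R]_n, N v^T <= C * `|v|.
Proof.
exists (\sum_i N (delta_mx i 0)).
  by apply: sumr_ge0 => i _; apply: vnorm_ge0.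
move=> v; rewrite [v^T]cV_sum_delta (le_trans (vnorm_sum _))// mulr_suml.
apply: ler_sum => i _; rewrite vnormZ mulrC mxE.
by rewrite ler_wpM2l ?vnorm_ge0 ?rV_coord_le.
Qed.

Lemma vnorm_continuous y : continuous (fun v : 'rV[R]_n => N (y - v^T)).
Proof.
have [C C0 NC] := vnorm_le_mx_norm.
have N_lip v w : `|N (y - v^T) - N (y - w^T)| <= C * `|v - w|.
  have half a b : N (y - a^T) - N (y - b^T) <= C * `|a - b|.
    apply: le_trans (vnormB_ge _ _) _.
    have -> : y - a^T - (y - b^T) = - (a - b)^T.
      by rewrite [(a - b)^T]linearB !opprB addrC addrA subrK.
    by rewrite vnormN.
  by rewrite ler_norml lerNl opprB half distrC half.
exact: lipschitz_rV_continuous C0 N_lip.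
Qed.

Lemma nearest_bounded_closed y (A : set 'rV[R]_n) :
  A !=set0 -> bounded_set A -> closed A ->
  exists2 v, A v & forall w, A w -> N (y - v^T) <= N (y - w^T).
Proof.
move=> A0 bA cA.
have [||v vA vmin] := @compact_EVT_min _ _ (fun v => N (y - v^T)) A A0.
- exact: bounded_closed_compact.
- exact/continuous_subspaceT/vnorm_continuous.
exists v; first by rewrite inE in vA.
by move=> w wA; apply: vmin; rewrite inE.
Qed.

(** [K] is the inverse of the minimum of [N] on the sup-norm unit sphere, attained by compactness
    and positive. *)
Lemma mx_norm_le_vnorm :
  exists2 K, 0 < K & forall v : 'rV[R]_n, `|v| <= K * N v^T.
Proof.
pose S := [set v : 'rV[R]_n | `|v| = 1].
have normS v : v != 0 -> S (`|v|^-1 *: v).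
  by move=> v0; rewrite /S /= normrZ normfV normr_id mulVf ?normr_eq0.
(* The sphere is empty when [n = 0]; any constant then works. *)
have [S0|S0] := pselect (S !=set0); last first.
  exists 1 => // v; have [->|v0] := eqVneq v 0.
    by rewrite normr0 mul1r vnorm_ge0.
  by exfalso; apply: S0; exists (`|v|^-1 *: v); apply: normS.
have [||v Sv vmin] := @nearest_bounded_closed (0 : 'cV_n) S S0.
- by exists 1; split => // M M1 v /= ->; apply: ltW.
- rewrite (_ : S = (fun v => `|v|) @^-1` [set 1])//.
  apply: preimage_closed; last exact: closed_eq.
  by move=> x _; exact: norm_continuous.
have v0 : v != 0.
  by apply: contra_eqN Sv => /eqP ->; rewrite normr0 eq_sym oner_eq0.
have Nv0 : 0 < N v^T by apply: vnorm_gt0; rewrite trmx_eq0.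
exists (N v^T)^-1; first by rewrite invr_gt0.
move=> w; have [->|w0] := eqVneq w 0.
  by rewrite normr0 mulr_ge0 ?invr_ge0 ?vnorm_ge0.
have := vmin _ (normS _ w0).
rewrite !sub0r !vnormN linearZ/= vnormZ normfV normr_id.
by rewrite mulrC ler_pdivlMr ?normr_gt0// mulrC -ler_pdivlMr// mulrC.
Qed.

End Norm.

(** * Norming functionals by finite-dimensional Hahn-Banach *)

Section HahnBanach.
Variables (R : realType) (n : nat) (N : 'cV[R]_n -> R).
Hypothesis hN : is_norm N.

(* A possibly multivalued "linear form on a subspace", given by its graph: adding a
   generator then needs no linear independence. *)
Definition linear_graph (S : R -> 'cV[R]_n -> Prop) : Prop :=
  S 0 0 /\ forall c l z l' z', S l z -> S l' z' -> S (c * l + l') (c *: z + z').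

(** The value [c] at [g] must lie above every [l - N (z - g)] and below every [N (z + g) - l]; the
    triangle inequality separates these families. Homogeneity reduces a nonzero coefficient [b] to
    [1] or [-1]. *)
Lemma hahn_banach_step (S : R -> 'cV[R]_n -> Prop) (g : 'cV[R]_n) :
  linear_graph S -> (forall l z, S l z -> l <= N z) ->
  exists c, forall l z b, S l z -> l + b * c <= N (z + b *: g).
Proof.
move=> [S0 SD] SN.
have SZ c l z : S l z -> S (c * l) (c *: z).
  by move=> Slz; have := SD c _ _ _ _ Slz S0; rewrite !addr0.
pose A := [set r : R | exists l z, S l z /\ r = l - N (z - g)].
have A_le l z : S l z -> ubound A (N (z + g) - l).
  move=> Slz _ [l' [z' [Slz' ->]]].
  have := SN _ _ (SD 1 _ _ _ _ Slz Slz'); rewrite mul1r scale1r.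
  have := vnormD hN (z + g) (z' - g).
  rewrite addrACA subrr addr0; lra.
have A0 : A !=set0 by exists (0 - N (0 - g)); exists 0, 0.
have c_le l z : S l z -> sup A <= N (z + g) - l.
  by move=> Slz; apply: ge_sup => //; apply: A_le.
have le_c l z : S l z -> l - N (z - g) <= sup A.
  move=> Slz; apply: ub_le_sup; last by exists l, z.
  by exists (N (0 + g) - 0); apply: A_le.
exists (sup A) => l z b Slz.
have [b0|b0|->] := ltgtP b 0; last first.
- by rewrite mul0r scale0r !addr0; apply: SN.
- have := c_le _ _ (SZ b^-1 _ _ Slz).
  rewrite -(ler_pM2l b0) mulrBr mulrA divff ?gt_eqF// mul1r.
  rewrite (vnormZ_gt0 hN)// scalerDr scalerA divff ?gt_eqF//.
  rewrite scale1r; lra.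
- have nb0 : 0 < - b by rewrite oppr_gt0.
  have := le_c _ _ (SZ (- b)^-1 _ _ Slz).
  rewrite -(ler_pM2l nb0) mulrBr mulrA divff ?gt_eqF// mul1r.
  rewrite (vnormZ_gt0 hN)// scalerBr scalerA divff ?gt_eqF//.
  rewrite scale1r scaleNr opprK; lra.
Qed.

Lemma hahn_banach_seq (gs : seq 'cV[R]_n) (S : R -> 'cV[R]_n -> Prop) :
  linear_graph S -> (forall l z, S l z -> l <= N z) ->
  exists S', [/\ linear_graph S', forall l z, S' l z -> l <= N z,
    forall l z, S l z -> S' l z & {in gs, forall g, exists c, S' c g}].
Proof.
move=> Slin SN; elim: gs => [|g gs [S' [[S'0 S'D] S'N SS' S'gs]]]; first by exists S.
have [c cN] := hahn_banach_step g (conj S'0 S'D) S'N.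
pose S2 l z := exists l' z' b, [/\ S' l' z', l = l' + b * c & z = z' + b *: g].
have S'S2 l z : S' l z -> S2 l z.
  by move=> Slz; exists l, z, 0; rewrite mul0r scale0r !addr0.
exists S2; split.
- split; first exact: S'S2.
  move=> a _ _ _ _ [l1 [z1 [b1 [S1 -> ->]]]] [l2 [z2 [b2 [Sl2 -> ->]]]].
  exists (a * l1 + l2), (a *: z1 + z2), (a * b1 + b2); split.
  + exact: S'D.
  + by rewrite mulrDr mulrDl addrACA mulrA.
  + by rewrite scalerDr scalerDl addrACA scalerA.
- by move=> _ _ [l [z [b [Slz -> ->]]]]; apply: cN.
- by move=> l z /SS'; apply: S'S2.
- move=> h; rewrite inE => /predU1P[->|/S'gs[d S'd]].
    by exists c, 0, 0, 1; rewrite mul1r scale1r !add0r.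
  by exists d; apply: S'S2.
Qed.

Lemma norming_functional (x : 'cV[R]_n) :
  exists2 u : 'cV[R]_n, forall y, (u^T *m y) 0 0 <= N y & (u^T *m x) 0 0 = N x.
Proof.
pose S l z := exists a, l = a * N x /\ z = a *: x.
have Slin : linear_graph S.
  split; first by exists 0; rewrite mul0r scale0r.
  move=> c _ _ _ _ [a [-> ->]] [b [-> ->]]; exists (c * a + b).
  by rewrite mulrDl scalerDl mulrA scalerA.
have SN l z : S l z -> l <= N z.
  by move=> [a [-> ->]]; rewrite (vnormZ hN) ler_wpM2r ?vnorm_ge0 ?ler_norm.
pose gs := [seq delta_mx i 0 : 'cV[R]_n | i <- enum 'I_n].
have [S' [[S'0 S'D] S'N SS' S'gs]] := hahn_banach_seq gs Slin SN.
have {}S'gs i : exists c, S' c (delta_mx i 0).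
  by apply/S'gs/mapP; exists i; rewrite ?mem_enum.
have [f S'f] := boolp.choice S'gs.
pose u : 'cV[R]_n := \col_i f i.
have uE y : (u^T *m y) 0 0 = \sum_i y i 0 * f i.
  by rewrite mxE; apply: eq_bigr => i _; rewrite !mxE mulrC.
have S'u y : S' ((u^T *m y) 0 0) y.
  rewrite {2}[y]cV_sum_delta uE; elim/big_rec2: _ => // i l z _ Slz.
  exact: S'D.
have uN y : (u^T *m y) 0 0 <= N y by apply: S'N.
exists u => //; apply/eqP; rewrite eq_le uN /=.
(* The graph may be multivalued, but two values at [x] differ by a value at 0, which [N 0 = 0]
   bounds. *)
have S'x : S' (N x) x by apply: SS'; exists 1; rewrite mul1r scale1r.
have /S'N := S'D (-1) _ _ _ _ (S'u x) S'x.
by rewrite scaleN1r addNr vnorm0// mulN1r addrC subr_le0.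
Qed.

End HahnBanach.

(** * Dual and parameter norms, residuals, perturbations *)

Section ParamNorm.
Variables (R : realType) (m n : nat) (N : 'cV[R]_n -> R).
Hypothesis hN : is_norm N.

Lemma dual_norm_le (u : 'cV[R]_n) (c : R) :
  0 <= c -> (forall y, (u^T *m y) 0 0 <= c * N y) -> dual_norm N u <= c.
Proof.
move=> c0 uc; apply: ge_sup.
  by exists `|(u^T *m (0 : 'cV_n)) 0 0|, 0 => //=; rewrite vnorm0// ler01.
move=> _ [y /= Ny <-]; apply: (@le_trans _ _ (c * N y)); last by rewrite ler_piMr.
rewrite ler_norml uc andbT lerNl.
by have := uc (- y); rewrite mulmxN mxE (vnormN hN).
Qed.

Lemma dual_norm_ge (u y : 'cV[R]_n) : `|(u^T *m y) 0 0| <= dual_norm N u * N y.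
Proof.
have [K K0 NK] := mx_norm_le_vnorm hN.
(* [sup] is guaranteed to dominate the set only once it is bounded; norm equivalence provides the
   bound. *)
have ub : has_ubound [set `|(u^T *m x) 0 0| | x in [set x | N x <= 1]].
  exists (\sum_i `|u i 0| * K) => _ [x /= Nx <-].
  rewrite mxE (le_trans (ler_norm_sum _ _ _))// ler_sum// => i _.
  rewrite normrM mxE ler_wpM2l//.
  have -> : x i 0 = x^T 0 i by rewrite mxE.
  rewrite (le_trans (rV_coord_le _ _))// (le_trans (NK _))// trmxK.
  by rewrite ler_piMr// ltW.
have [->|y0] := eqVneq y 0; first by rewrite mulmx0 mxE normr0 vnorm0// mulr0.
have Ny : 0 < N y by apply: vnorm_gt0.
rewrite -ler_pdivrMr//; apply: ub_le_sup => //; exists ((N y)^-1 *: y) => /=.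
  by rewrite (vnormZ hN) normfV gtr0_norm// mulVf ?gt_eqF.
by rewrite -scalemxAr mxE normrM normfV (gtr0_norm Ny) mulrC.
Qed.

Implicit Types (A : 'M[R]_(m, n)) (b : 'cV[R]_m).

Lemma param_norm_ge0 A b : 0 <= param_norm N A b.
Proof. exact: bigmax_ge_id. Qed.

Lemma param_norm_le A b c : 0 <= c ->
  (forall t, dual_norm N (row t A)^T <= c) -> (forall t, `|b t 0| <= c) ->
  param_norm N A b <= c.
Proof. by move=> c0 Ac bc; apply: bigmax_le => // t _; rewrite ge_max Ac bc. Qed.

Lemma param_norm_ge A b x t :
  b t 0 - (A *m x) t 0 <= param_norm N A b * (1 + N x).
Proof.
set P := param_norm N A b.
have := le_bigmax 0 (fun t => Num.max (dual_norm N (row t A)^T) `|b t 0|) t.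
rewrite -/(param_norm N A b) -/P ge_max => /andP[AP bP].
have := dual_norm_ge (row t A)^T x; rewrite trmxK -row_mul mxE.
have := ler_wpM2r (vnorm_ge0 hN x) AP.
rewrite mulrDr mulr1 => AxP Ax.
apply: lerD; first exact: le_trans (ler_norm _) bP.
by rewrite (le_trans (ler_norm _))// normrN (le_trans Ax).
Qed.

Lemma feas_residual A0 b0 A b x t : feas A b x ->
  (A0 *m x) t 0 - b0 t 0 <= param_norm N (A - A0) (b - b0) * (1 + N x).
Proof.
move=> /(_ t) Axb; apply: le_trans (param_norm_ge _ _ _ _).
by rewrite mulmxBl !mxE; move: Axb; rewrite mxE; lra.
Qed.

(** Subtracting [d u^T] from each row and adding [d] to each right-hand side lowers every residual
    at [x] by [d (1 + N x)]; the change has size at most [d] because [u] is dominated by [N]. *)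
Lemma feas_perturbation A b x (d : R) : 0 <= d ->
  (forall t, (A *m x) t 0 - b t 0 <= d * (1 + N x)) ->
  exists A' b', feas A' b' x /\ param_norm N (A' - A) (b' - b) <= d.
Proof.
move=> d0 xd; have [u uN ux] := norming_functional hN x.
exists (A - const_mx d *m u^T), (b + const_mx d); split.
  move=> t; rewrite mulmxBl -mulmxA !mxE big_ord1 ux mxE.
  by have := xd t; rewrite mxE; lra.
rewrite addrAC subrr add0r addrAC subrr add0r.
apply: param_norm_le => // t; last by rewrite mxE ger0_norm.
apply: dual_norm_le => // y; rewrite trmxK -row_mul mulNmx -mulmxA !mxE big_ord1 mxE.
have := uN (- y); rewrite mulmxN mxE (vnormN hN) -mulrN => uy.
by rewrite ler_wpM2l.
Qed.

End ParamNorm.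

(** * Polyhedra *)

Lemma near0_mul_lt (R : realType) (a c : R) :
  0 < c -> \forall s \near 0^'+, s * a < c.
Proof.
move=> c0; have a1 : 0 < `|a| + 1 by rewrite ltr_wpDl.
near=> s; have s0 : 0 < s by near: s; exact: nbhs_right_gt.
apply: (@le_lt_trans _ _ (s * (`|a| + 1))).
  by rewrite ler_pM2l// (le_trans (ler_norm _))// lerDl.
rewrite -ltr_pdivlMr//; near: s; apply: nbhs_right_lt; exact: divr_gt0.
Unshelve. all: by end_near. Qed.

Section Polyhedron.
Variables (R : realType) (m n : nat) (A : 'M[R]_(m, n)) (b : 'cV[R]_m).
Local Notation F := (feas A b).
Implicit Types (v w p d : 'cV[R]_n) (t : 'I_m).

Definition active v : {set 'I_m} := [set t | (A *m v) t 0 == b t 0]%SET.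

Lemma mulmx_coordD v d t : (A *m (v + d)) t 0 = (A *m v) t 0 + (A *m d) t 0.
Proof. by rewrite mulmxDr mxE. Qed.

Lemma mulmx_coordZ s d t : (A *m (s *: d)) t 0 = s * (A *m d) t 0.
Proof. by rewrite -scalemxAr mxE. Qed.

Lemma mulmx_coordN d t : (A *m - d) t 0 = - (A *m d) t 0.
Proof. by rewrite mulmxN mxE. Qed.

(** Active constraints do not increase along [d]; the finitely many others have positive slack. *)
Lemma feas_near v d : F v -> {in active v, forall t, (A *m d) t 0 <= 0} ->
  \forall s \near 0^'+, F (v + s *: d).
Proof.
move=> Fv vd; apply: filter_forall => t.
have [tv|] := boolP (t \in active v).
  near=> s; have s0 : 0 < s by near: s; exact: nbhs_right_gt.
  by rewrite mulmx_coordD mulmx_coordZ -lerBrDl (@le_trans _ _ 0) ?subr_ge0// pmulr_rle0// vd.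
rewrite inE => tv; near=> s; rewrite mulmx_coordD mulmx_coordZ -lerBrDl ltW//.
by near: s; apply: near0_mul_lt; rewrite subr_gt0 lt_neqAle Fv andbT.
Unshelve. all: by end_near. Qed.

(** Ratio test of the simplex method: [s] is the least step at which a constraint increasing along
    [d] becomes tight. That constraint is new, since [d] is neutral on the active ones. *)
Lemma feas_step v d : F v -> {in active v, forall t, (A *m d) t 0 = 0} ->
  (exists t, 0 < (A *m d) t 0) ->
  exists s, [/\ 0 < s, F (v + s *: d) & active v \proper active (v + s *: d)].
Proof.
move=> Fv vd [t0 dt0].
pose ratio t := (b t 0 - (A *m v) t 0) / (A *m d) t 0.
case: (@Order.TotalTheory.arg_minP _ _ _ t0 (fun t => 0 < (A *m d) t 0) ratio dt0) => t dt tmin.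
have vt : t \notin active v by apply/negP => /vd dt_eq0; rewrite dt_eq0 ltxx in dt.
have s0 : 0 < ratio t.
  rewrite divr_gt0// subr_gt0 lt_neqAle Fv andbT.
  by rewrite inE in vt.
exists (ratio t); split => //.
  move=> r; rewrite mulmx_coordD mulmx_coordZ -lerBrDl.
  have [dr|dr] := ltP 0 ((A *m d) r 0).
    by rewrite -ler_pdivlMr//; apply: tmin.
  by rewrite (@le_trans _ _ 0) ?subr_ge0// pmulr_rle0.
apply/properP; split.
  apply/fintype.subsetP => r rv; move: (vd _ rv); move: rv; rewrite !inE => /eqP <- dr.
  by rewrite mulmx_coordD mulmx_coordZ dr mulr0 addr0.
by exists t => //; rewrite inE mulmx_coordD mulmx_coordZ (divfK (lt0r_neq0 dt)) addrC subrK.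
Qed.

(** With equal active sets, [v - w] is neutral on the active constraints, so [v] is the midpoint of
    two feasible points [v + s (v - w)] and [v - s (v - w)]. *)
Lemma extr_feas_active_inj v w :
  extr F v -> extr F w -> active v = active w -> v = w.
Proof.
move=> [Fv v_extr] [Fw _] vw; apply/eqP; rewrite -subr_eq0; apply/eqP.
have vd : {in active v, forall t, (A *m (v - w)) t 0 = 0}.
  move=> t tv; rewrite mulmx_coordD mulmx_coordN; move: (tv); rewrite {1}vw.
  by move: tv; rewrite !inE => /eqP -> /eqP ->; rewrite subrr.
have vdN : {in active v, forall t, (A *m - (v - w)) t 0 <= 0}.
  by move=> t tv; rewrite mulmx_coordN vd// oppr0.
have {}vd : {in active v, forall t, (A *m (v - w)) t 0 <= 0}.
  by move=> t tv; rewrite vd.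
have [s [s0 Fs FsN]] : exists s, [/\ 0 < s, F (v + s *: (v - w)) & F (v + s *: - (v - w))].
  near (0 : R)^'+ => s; exists s; split; near: s;
    [exact: nbhs_right_gt|exact: feas_near|exact: feas_near].
have l0 : (0 : R) < 2^-1 by rewrite invr_gt0.
have l1 : (2^-1 : R) < 1 by rewrite invf_lt1// ltr1n.
have : v = 2^-1 *: (v + s *: (v - w)) + (1 - 2^-1) *: (v + s *: - (v - w)).
  by apply/colP => i; rewrite !mxE; lra.
move=> /(v_extr _ _ _ Fs FsN l0 l1) /addrI /(scalerI (lt0r_neq0 s0)) /eqP.
rewrite -subr_eq0 opprK -mulr2n -scaler_nat scaler_eq0 pnatr_eq0 /=.
by move=> /eqP.
Unshelve. all: by end_near. Qed.

Variable N : 'cV[R]_n -> R.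
Hypothesis hN : is_norm N.

(** A short step from [p] towards [q] stays in [F]; convexity of [N] then turns this local
    minimality of [p] into the comparison with [q]. *)
Lemma feas_nearest_cone x p v q :
  F p -> (forall w, F w -> N (x - p) <= N (x - w)) ->
  active p \subset active v -> {in active v, forall t, (A *m q) t 0 <= b t 0} ->
  N (x - p) <= N (x - q).
Proof.
move=> Fp pmin /fintype.subsetP pv vq.
have qp : {in active p, forall t, (A *m (q - p)) t 0 <= 0}.
  move=> t tp; rewrite mulmx_coordD mulmx_coordN subr_le0; have := vq _ (pv _ tp).
  by move: tp; rewrite inE => /eqP ->.
have [s [s0 s1 Fs]] : exists s, [/\ 0 < s, s < 1 & F (p + s *: (q - p))].
  near (0 : R)^'+ => s; exists s; split; near: s;
    [exact: nbhs_right_gt|exact: nbhs_right_lt|exact: feas_near].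
have := pmin _ Fs.
have -> : x - (p + s *: (q - p)) = (1 - s) *: (x - p) + s *: (x - q).
  by apply/colP => i; rewrite !mxE; lra.
move=> /le_trans /(_ (vnormD hN _ _)); rewrite !(vnormZ hN) !gtr0_norm ?subr_gt0//.
have := vnorm_ge0 hN (x - q); have := vnorm_ge0 hN (x - p); nra.
Unshelve. all: by end_near. Qed.

Variable M : R.
Hypothesis bF : forall x, F x -> N x <= M.

Lemma feas_pointed v d : F v -> (forall t, (A *m d) t 0 <= 0) -> d = 0.
Proof.
move=> Fv dle; apply/eqP; apply: contraT => d0.
have Nd : 0 < N d by apply: vnorm_gt0.
(* Chosen so that [N (s *: d) = M + N v + 1], which pushes [v + s *: d] beyond norm [M]. *)
pose s := (M + N v + 1) / N d.
have M0 : 0 <= M by apply: le_trans (bF Fv); apply: vnorm_ge0.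
have s0 : 0 < s.
  by rewrite divr_gt0// ltr_wpDl// addr_ge0// vnorm_ge0.
have Fs : F (v + s *: d).
  by move=> t; rewrite mulmx_coordD mulmx_coordZ -[leRHS]addr0 lerD// pmulr_rle0.
have := vnormB_ge hN (s *: d) (- v); rewrite opprK addrC vnormN// [s *: d + v]addrC.
have := bF Fs; rewrite -(vnormZ_gt0 hN)// divfK ?gt_eqF//; lra.
Qed.

(** The kernel of [A] consists of recession directions, hence is trivial, so [A^T] has a right
    inverse. *)
Lemma row_span_bounded x : F !=set0 -> row_span A x.
Proof.
move=> [v Fv]; have /row_freeP [B AB] : row_free A^T.
  apply: inj_row_free => y yA; apply: trmx_inj; rewrite trmx0.
  apply: (feas_pointed Fv) => t.
  by rewrite -(trmxK A) -trmx_mul yA trmx0 mxE.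
by exists (B *m x); rewrite mulmxA AB mul1mx.
Qed.

Lemma Eset_bounded : F !=set0 -> Eset A b = extr F.
Proof.
move=> F0; rewrite /Eset; congr extr; apply/seteqP; split => [x []//|x Fx].
by split=> //; apply: row_span_bounded.
Qed.

Lemma exists_nearest x : F !=set0 ->
  exists2 p, F p & forall w, F w -> N (x - p) <= N (x - w).
Proof.
move=> [v Fv]; have [K K0 NK] := mx_norm_le_vnorm hN.
pose B := [set y : 'rV[R]_n | F y^T].
have [||| y By ymin] := @nearest_bounded_closed _ _ _ hN x B.
- by exists v^T; rewrite /B /= trmxK.
- exists (K * M); split; first exact: num_real.
  move=> L KL y By /=; rewrite (le_trans (NK y))// (le_trans _ (ltW KL))//.
  by rewrite ler_pM2l// bF.
- rewrite (_ : B = \bigcap_(t in [set: 'I_m]) (fun y => (A *m y^T) t 0) @^-1` [set r | r <= b t 0]).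
    apply: closed_bigI => t _; apply: preimage_closed; last exact: closed_le.
    move=> y _; apply: (@lipschitz_rV_continuous _ _ _ (\sum_j `|A t j|)) => [|{}y w].
      exact: sumr_ge0.
    rewrite !mxE -sumrB mulr_suml (le_trans (ler_norm_sum _ _ _))// ler_sum// => j _.
    rewrite -mulrBr normrM ler_wpM2l// !mxE.
    by have := rV_coord_le (y - w) j; rewrite !mxE.
  by apply/seteqP; split => y; [move=> By t _; exact: By|move=> By t; exact: By].
by exists y^T => // w Fw; have := ymin w^T; rewrite trmxK; apply; rewrite /B /= trmxK.
Qed.

(** Induction on the number of inactive constraints. A point that is not extreme lies inside a
    segment of its face; moving both ways until a new constraint is tight, one of the two ends has
    norm at least [N p] by convexity. *)
Lemma exists_extr p : F p ->
  exists v, [/\ extr F v, active p \subset active v & N p <= N v].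
Proof.
have [k] := ubnP (m - #|active p|); elim: k p => // k IH p; rewrite ltnS => pk Fp.
have [p_extr|] := pselect (extr F p); first by exists p.
rewrite /extr /= => /not_andP[//|].
move=> /existsNP[y] /existsNP[z] /existsNP[l].
move=> /not_implyP[Fy] /not_implyP[Fz] /not_implyP[l0] /not_implyP[l1].
move=> /not_implyP[pE] /eqP yz.
(* At an active constraint, [b t 0] is a proper convex combination of two values at most [b t 0], so
   both equal it. *)
have pd : {in active p, forall t, (A *m (y - z)) t 0 = 0}.
  move=> t; rewrite inE mulmx_coordD mulmx_coordN => /eqP.
  have -> : (A *m p) t 0 = l * (A *m y) t 0 + (1 - l) * (A *m z) t 0.
    by rewrite pE mulmx_coordD !mulmx_coordZ.
  have := Fy t; have := Fz t; nra.
have pdN : {in active p, forall t, (A *m (z - y)) t 0 = 0}.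
  by move=> t tp; rewrite -opprB mulmx_coordN pd// oppr0.
have pos d : d != 0 -> exists t, 0 < (A *m d) t 0.
  move=> d0; apply: contrapT => /forallNP dle; move/eqP: d0; apply.
  by apply: (feas_pointed Fp) => t; rewrite leNgt; apply/negP/dle.
have yz0 : y - z != 0 by rewrite subr_eq0.
have zy0 : z - y != 0 by rewrite subr_eq0 eq_sym.
have [s1 [s10 Fs1 ps1]] := feas_step Fp pd (pos _ yz0).
have [s2 [s20 Fs2 ps2]] := feas_step Fp pdN (pos _ zy0).
have climb w : F w -> active p \proper active w -> N p <= N w ->
    exists v, [/\ extr F v, active p \subset active v & N p <= N v].
  move=> Fw pw Npw; have := proper_card pw => cpw.
  have cw : (#|active w| <= m)%N by rewrite (leq_trans (max_card _))// card_ord.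
  have [|v [v_extr wv Nwv]] := IH w _ Fw.
    by apply: leq_trans pk; rewrite ltn_sub2l// (leq_trans cpw).
  exists v; split => //; last exact: le_trans Nwv.
  exact: fintype.subset_trans (proper_sub pw) wv.
have [Ns1|Ns1] := leP (N p) (N (p + s1 *: (y - z))); first exact: (climb (p + s1 *: (y - z))).
apply: (climb (p + s2 *: (z - y))) => //.
have : (s1 + s2) *: p = s2 *: (p + s1 *: (y - z)) + s1 *: (p + s2 *: (z - y)).
  by apply/colP => i; rewrite !mxE; lra.
move/(congr1 N) => NE; have := vnormD hN (s2 *: (p + s1 *: (y - z))) (s1 *: (p + s2 *: (z - y))).
rewrite -NE -!(vnormZ_gt0 hN)// ?addr_gt0//.
set N1 := N (p + s1 *: _) in Ns1 *; set N2 := N (p + s2 *: _); nra.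
Qed.

End Polyhedron.

(** * Calmness and Lipschitz upper semicontinuity *)

Section Moduli.
Variables (R : realType) (m n : nat) (N : 'cV[R]_n -> R).
Variables (A : 'M[R]_(m, n)) (b : 'cV[R]_m).
Hypothesis hN : is_norm N.
Local Notation F := (feas A b).

Lemma clm_le_Lipusc v : (clm N A b v <= Lipusc N A b)%E.
Proof.
apply: ereal_inf_le_tmp => _ [k [k0 [d d0 kd]] <-]; exists k => //.
split=> //; exists d => //; exists 1 => // A' b' A'd x Fx _; exact: kd.
Qed.

Lemma calm_vertex_bound k d e v x p rho :
  0 <= k -> 0 < d -> 0 < e ->
  (forall A' b', param_norm N (A' - A) (b' - b) < d ->
    forall y, feas A' b' y -> N (y - v) < e ->
    (dist N y F <= (k * param_norm N (A' - A) (b' - b))%:E)%E) ->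
  F v -> F p -> (forall w, F w -> N (x - p) <= N (x - w)) ->
  active A b p \subset active A b v ->
  0 <= rho -> (forall t, (A *m x) t 0 - b t 0 <= rho) ->
  N (x - p) * (1 + N v) <= k * rho.
Proof.
move=> k0 d0 e0 kde Fv Fp pmin pv rho0 xrho; rewrite leNgt; apply/negP.
set D := N (x - p) => kD.
(* One small [s] serves all purposes: the contracted point is within [e] of [v], its perturbation is
   below [d], replacing [N v] by its norm keeps the strict inequality [kD], and constraints inactive
   at [v] stay satisfied. *)
have [s [s0 sN [sd sD sA]]] : exists s, [/\ 0 < s, s * N (x - v) < e & [/\ s * rho < d,
    s * (D * N (x - v)) < D * (1 + N v) - k * rho
    & forall t, t \notin active A b v ->
        s * (A *m (x - v)) t 0 < b t 0 - (A *m v) t 0]].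
  near (0 : R)^'+ => s; exists s; do ?split; near: s.
  - exact: nbhs_right_gt.
  - exact: near0_mul_lt.
  - exact: near0_mul_lt.
  - by apply: near0_mul_lt; rewrite subr_gt0.
  - apply: filter_forall => t; have [tv|tv] := boolP (t \in active A b v).
      exact: nearW.
    near=> s => _; near: s; apply: near0_mul_lt.
    by rewrite subr_gt0 lt_neqAle Fv andbT; rewrite inE in tv.
pose y := v + s *: (x - v).
have yres t : (A *m y) t 0 - b t 0 <= s * rho.
  rewrite mulmx_coordD mulmx_coordZ; have [|tv] := boolP (t \in active A b v).
    rewrite inE mulmx_coordD mulmx_coordN => /eqP ->.
    have := ler_wpM2l (ltW s0) (xrho t); lra.
  have := sA _ tv; have : 0 <= s * rho by rewrite mulr_ge0// ltW.
  lra.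
have Ny1 : 0 < 1 + N y by rewrite ltr_pwDl// vnorm_ge0.
have [A' [b' [Fy A'y]]] : exists A' b', feas A' b' y /\
    param_norm N (A' - A) (b' - b) <= s * rho / (1 + N y).
  apply: feas_perturbation => //.
    by rewrite divr_ge0 ?mulr_ge0// ltW.
  by move=> t; rewrite divfK ?gt_eqF.
have A'd : param_norm N (A' - A) (b' - b) < d.
  rewrite (le_lt_trans A'y)// (le_lt_trans _ sd)// ler_pdivrMr//.
  by rewrite ler_peMr ?lerDl ?vnorm_ge0// mulr_ge0// ltW.
have yv : N (y - v) < e by rewrite addrAC subrr add0r -vnormZ_gt0.
have yD : ((s * D)%:E <= dist N y F)%E.
  apply: le_ereal_inf_tmp => _ [w Fw <-]; rewrite lee_fin.
  (* Dilating [w] from [v] by [s^-1] keeps it in the cone of [F] at [v], where [p] is still nearest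
     to [x]. *)
  have -> : y - w = s *: (x - (v + s^-1 *: (w - v))).
    apply/colP => i; rewrite !mxE; field; exact: lt0r_neq0.
  rewrite -vnormZ_gt0// ler_pM2l//; apply: (feas_nearest_cone hN Fp pmin pv).
  move=> t; rewrite inE mulmx_coordD mulmx_coordZ mulmx_coordD mulmx_coordN => /eqP ->.
  by rewrite gerDl pmulr_rle0 ?invr_gt0// subr_le0.
have := le_trans yD (kde _ _ A'd _ Fy yv); rewrite lee_fin.
move=> /le_trans /(_ (ler_wpM2l k0 A'y)).
rewrite !mulrA ler_pdivlMr// [k * s]mulrC -!mulrA ler_pM2l//.
have D0 : 0 <= D by apply: vnorm_ge0.
have yge : N v - s * N (x - v) <= N y.
  rewrite (vnormZ_gt0 hN)//.
  by have := vnormB_ge hN v (- (s *: (x - v))); rewrite opprK vnormN.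
have := ler_wpM2l D0 yge; lra.
Unshelve. all: by end_near. Qed.

Variable M : R.
Hypotheses (F0 : F !=set0) (bF : forall x, F x -> N x <= M).

Lemma Lipusc_le k k' : 0 <= k -> k < k' ->
  (forall v, extr F v -> (clm N A b v <= k%:E)%E) -> (Lipusc N A b <= k'%:E)%E.
Proof.
move=> k0 kk' clm_k.
(* Being above [k], [k1] exceeds some calmness constant at each extreme point; the gap up to [k']
   absorbs the term [D] in [1 + D] below. *)
have [k1 kk1 k1k'] : exists2 k1, k < k1 & k1 < k'.
  by exists ((k + k') / 2); lra.
have k1_gt0 : 0 < k1 by lra.
have k'_gt0 : 0 < k' by lra.
have kk_gt0 : 0 < k' * k1 by apply: mulr_gt0.
apply: ereal_inf_lbound; exists k' => //; split; first exact: ltW.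
(* The value of [P] at which [k1 / (1 - k1 P)] reaches [k']. *)
exists ((k' - k1) / (k' * k1)); first by rewrite divr_gt0 ?subr_gt0.
move=> A' b'; set P := param_norm _ _ _; rewrite ltr_pdivlMr// => Plt x Fx.
have P0 : 0 <= P by apply: param_norm_ge0.
have [p Fp pmin] := exists_nearest hN bF x F0.
have [v [v_extr pv Npv]] := exists_extr hN bF Fp.
have : (clm N A b v < k1%:E)%E by apply: le_lt_trans (clm_k _ v_extr) _; rewrite lte_fin.
move=> /ereal_inf_lt [_ [j [j0 [d d0 [e e0 jde]]] <-]]; rewrite lte_fin => jk1.
have rho0 : 0 <= P * (1 + N x) by rewrite mulr_ge0// addr_ge0// vnorm_ge0.
have := calm_vertex_bound j0 d0 e0 jde (proj1 v_extr) Fp pmin pv rho0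
  (fun t => feas_residual hN A b t Fx).
have := ler_wpM2r rho0 (ltW jk1).
set D := N (x - p) => jk1P /le_trans /(_ jk1P) {jk1P} DP.
have D0 : 0 <= D by apply: vnorm_ge0.
have Nv0 : 0 <= N v by apply: vnorm_ge0.
have NxD : N x <= N v + D by have := vnormB_ge hN x p; rewrite -/D; lra.
(* Since [N p <= N v], [1 + N x <= 1 + N v + D <= (1 + N v) (1 + D)], and the factor [1 + N v]
   cancels. *)
have {}DP : D <= k1 * P * (1 + D).
  have v1 : 0 < 1 + N v by lra.
  rewrite -(ler_pM2r v1); apply: le_trans DP _; rewrite -!mulrA.
  rewrite ler_pM2l// ler_wpM2l//.
  have := mulr_ge0 D0 Nv0; lra.
apply: le_trans (_ : (D%:E <= _)%E).
  by apply: ereal_inf_lbound; exists p.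
rewrite lee_fin -(ler_pM2l k1_gt0).
have := ler_wpM2l (ltW k'_gt0) DP; have := ler_wpM2r D0 (ltW Plt); lra.
Qed.

(** Extreme points are determined by their active sets, so the maximum is taken over the finite type
    of subsets of ['I_m]. *)
Lemma extr_feas_argmax (g : 'cV[R]_n -> \bar R) :
  exists2 v, extr F v & forall w, extr F w -> (g w <= g v)%E.
Proof.
pose rep (J : {set 'I_m}) := xget 0 [set v | extr F v /\ active A b v = J].
have repK v : extr F v -> rep (active A b v) = v.
  move=> v_extr; apply: xget_unique => // w [w_extr wv].
  exact: extr_feas_active_inj wv.
have [p Fp] := F0; have [v0 [v0_extr _ _]] := exists_extr hN bF Fp.
pose P (J : {set 'I_m}) := `[< exists2 v, extr F v & active A b v = J >].
have Pv v : extr F v -> P (active A b v) by move=> v_extr; apply/asboolP; exists v.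
case: (@Order.TotalTheory.arg_maxP _ _ _ (active A b v0) P (g \o rep) (Pv _ v0_extr)).
move=> J /asboolP[v v_extr <-] gmax; exists v => // w w_extr.
by have := gmax _ (Pv _ w_extr); rewrite /= !repK.
Qed.

End Moduli.

Theorem theorem5 (R : realType) (m n : nat) (N : 'cV[R]_n -> R)
  (Ab : 'M[R]_(m, n)) (bb : 'cV[R]_m) :
  is_norm N ->
  (exists x, feas Ab bb x) ->
  (exists M : R, forall x, feas Ab bb x -> N x <= M) ->
  (exists2 x, Eset Ab bb x & Lipusc N Ab bb = clm N Ab bb x) /\
  (forall x, Eset Ab bb x -> (clm N Ab bb x <= Lipusc N Ab bb)%E).
Proof.
move=> hN F0 [M bF]; split; last by move=> x _; exact: clm_le_Lipusc.
rewrite (Eset_bounded hN bF F0).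
have [v v_extr vmax] := extr_feas_argmax hN F0 bF (clm N Ab bb).
exists v => //; apply/eqP; rewrite eq_le clm_le_Lipusc andbT.
(* Each calmness constant [k] at the maximiser bounds the modulus at every extreme point, so [k + e]
   bounds [Lipusc] for all [e > 0]. *)
apply: le_ereal_inf_tmp => _ [k kv <-]; apply/lee_addgt0Pr => e e0.
rewrite -EFinD; apply: (Lipusc_le hN F0 bF (proj1 kv)); first by rewrite ltrDl.
move=> w w_extr; apply: le_trans (vmax _ w_extr) _.
by apply: ereal_inf_lbound; exists k.
Qed.
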